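(* Let $n\ge 2$, $\mathcal{V}=\{1,\dots,n\}$ and $k\in\{1,\dots,n-1\}$. Then the following inequalities are valid for $\mathcal{D}^n_k$, i.e., every $X\in\mathcal{D}^n_k$ satisfies: $$\sum_{i\in\mathcal{S}}\sum_{j\in\mathcal{S}'}X_{ij}\le\sum_{i\in\mathcal{S}'}X_{ii}+\sum_{i,j\in\mathcal{S}:\,i<j}X_{ij}+\sum_{i,j\in\mathcal{S}':\,i<j}X_{ij}\qquad\text{for all }\mathcal{S},\mathcal{S}'\subseteq\mathcal{V}\text{ with }\mathcal{S}\cap\mathcal{S}'=\emptyset,$$ and $$\sum_{i\in\mathcal{S}}X_{ii}\le\sum_{i,j\in\mathcal{S}:\,i<j}X_{ij}+k\qquad\text{for all }\mathcal{S}\subseteq\mathcal{V}.$$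
   Context: $\mathcal{D}^n_k$ is the set of real symmetric $n\times n$ matrices $X$ for which there exists a binary matrix $P\in\{0,1\}^{n\times k}$ with $X=PP^\top$ and $\sum_{c=1}^k P_{ic}\le 1$ for all $i\in\{1,\dots,n\}$. *)

(* Defs.v *)
From HB Require Import structures.
From mathcomp Require Import all_boot all_order all_algebra.
From mathcomp Require Import reals.

Set Implicit Arguments.
Unset Strict Implicit.
Unset Printing Implicit Defensive.

Import Order.TTheory GRing.Theory Num.Theory.
Local Open Scope ring_scope.

Definition binary_mx (R : realType) (n k : nat) (P : 'M[R]_(n, k)) : Prop :=
  forall i c, P i c = 0 \/ P i c = 1.

(* [D_set k X] reads X \in D^n_k, with n implicit in the type of X. *)
Definition D_set (R : realType) (n k : nat) (X : 'M[R]_n) : Prop :=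
  X^T = X /\
  exists P : 'M[R]_(n, k),
    [/\ binary_mx P, X = P *m P^T & forall i, \sum_(c < k) P i c <= 1].

(* Main.v *)
(** Every entry of X = P P^T is a sum over the columns of P, so both
    inequalities can be checked one column at a time. If a and b count the ones
    of a 0/1 column inside S and S', they read
    a b <= b + a (a - 1) / 2 + b (b - 1) / 2 and a <= a (a - 1) / 2 + 1,
    that is z <= z^2 for the integers z = a - b and z = a - 1. *)
Require Import Defs.
From mathcomp Require Import all_boot all_order all_algebra.
From mathcomp Require Import reals.
From mathcomp Require Import lra.

Import Order.TTheory GRing.Theory Num.Theory.
Local Open Scope ring_scope.

(** The square [S] x [S] splits into its diagonal and two triangles, which symmetry makes equal. *)
Lemma sum_sym_pairs (R : pzRingType) (n : nat) (S : {set 'I_n})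
    (F : 'I_n -> 'I_n -> R) (Fsym : forall i j, F i j = F j i) :
  \sum_(i in S) \sum_(j in S) F i j =
    \sum_(i in S) F i i + (\sum_(i in S) \sum_(j in S | (i < j)%N) F i j) *+ 2.
Proof.
have lower : \sum_(i in S) \sum_(j in S | (j < i)%N) F i j =
    \sum_(i in S) \sum_(j in S | (i < j)%N) F i j.
  rewrite (exchange_big_dep (mem S)) /=; last by move=> i j _ /andP[].
  apply: eq_bigr => i iS; apply: eq_big => [j|j _]; last exact: Fsym.
  by rewrite iS.
(* One of the two copies becomes the lower triangle again, so the identity can be checked row by
   row. *)
rewrite mulr2n -{1}lower -!big_split /=; apply: eq_bigr => i iS.
rewrite (bigD1 i) //= (bigID (fun j : 'I_n => (j < i)%N)) /=.
congr (_ + (_ + _)); apply: eq_bigl => j; rewrite -val_eqE /=.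
- by case: (j \in S); case: ltngtP.
- by case: (j \in S); case: ltngtP.
Qed.

Section BinaryVector.
Variables (R : archiRealDomainType) (n : nat) (x : 'I_n -> R).
Hypothesis x01 : forall i, x i = 0 \/ x i = 1.

Let binary_idem i : x i * x i = x i.
Proof. by case: (x01 i) => ->; rewrite ?mulr0 ?mulr1. Qed.

(** Integrality is what gives [z <= z ^+ 2], which fails strictly between 0 and 1. *)
Lemma binary_sum_int (S : {set 'I_n}) : \sum_(i in S) x i \is a Num.int.
Proof. by apply: rpred_sum => i _; case: (x01 i) => ->; rewrite ?rpred0 ?rpred1. Qed.

(** Idempotence of 0 and 1 makes the diagonal of the expanded square linear; this is how the pair
    sum becomes a (a - 1) / 2. *)
Lemma binary_sum_sqr (S : {set 'I_n}) :
  (\sum_(i in S) x i) ^+ 2 = \sum_(i in S) x i +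
    (\sum_(i in S) \sum_(j in S | (i < j)%N) x i * x j) *+ 2.
Proof.
rewrite -[X in _ = X + _](eq_bigr _ (fun i _ => binary_idem i)).
rewrite -(@sum_sym_pairs R n S (fun i j => x i * x j)) => [|i j]; last exact: mulrC.
by rewrite expr2 big_distrlr.
Qed.

Lemma binary_two_sets (S S' : {set 'I_n}) :
  \sum_(i in S) \sum_(j in S') x i * x j <=
    \sum_(i in S') x i * x i
    + \sum_(i in S) \sum_(j in S | (i < j)%N) x i * x j
    + \sum_(i in S') \sum_(j in S' | (i < j)%N) x i * x j.
Proof.
(* The sign of z = a - b matters: once a^2 and b^2 are replaced, a cancels and 2 b stays on the
   right, as the sum over [S'] requires. *)
have z2 := intr_ler_sqr (rpredB (binary_sum_int S) (binary_sum_int S')).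
rewrite (eq_bigr _ (fun i _ => binary_idem i)) -big_distrlr /=.
move: z2 (binary_sum_sqr S) (binary_sum_sqr S'); rewrite sqrrB; lra.
Qed.

Lemma binary_one_set (S : {set 'I_n}) :
  \sum_(i in S) x i * x i <=
    \sum_(i in S) \sum_(j in S | (i < j)%N) x i * x j + 1.
Proof.
have z2 := intr_ler_sqr (rpredB (binary_sum_int S) (rpred1 _)).
rewrite (eq_bigr _ (fun i _ => binary_idem i)).
move: z2 (binary_sum_sqr S); rewrite sqrrB1; lra.
Qed.

End BinaryVector.

Theorem theorem4p1 (R : realType) (n k : nat) (n_ge2 : (2 <= n)%N)
    (k_range : (1 <= k <= n - 1)%N) (X : 'M[R]_n) (XD : D_set k X) :
  (forall S S' : {set 'I_n}, S :&: S' = set0 ->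
     \sum_(i in S) \sum_(j in S') X i j <=
       \sum_(i in S') X i i
       + \sum_(i in S) \sum_(j in S | (i < j)%N) X i j
       + \sum_(i in S') \sum_(j in S' | (i < j)%N) X i j)
  /\
  (forall S : {set 'I_n},
     \sum_(i in S) X i i <=
       \sum_(i in S) \sum_(j in S | (i < j)%N) X i j + k%:R).
Proof.
case: XD => _ [P [P01 XE _]].
have entry i j : X i j = \sum_(c < k) P i c * P j c.
  by rewrite XE mxE; apply: eq_bigr => c _; rewrite mxE.
have sum1 (S : {set 'I_n}) :
    \sum_(i in S) X i i = \sum_(c < k) \sum_(i in S) P i c * P i c.
  by rewrite exchange_big; apply: eq_bigr => i _; exact: entry.
(* Letting [Q] depend on [i] covers both the full sums over [S'] and the sums restricted to
   [i < j]. *)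
have sum2 (S : {set 'I_n}) (Q : 'I_n -> pred 'I_n) :
    \sum_(i in S) \sum_(j | Q i j) X i j =
    \sum_(c < k) \sum_(i in S) \sum_(j | Q i j) P i c * P j c.
  rewrite exchange_big; apply: eq_bigr => i _; rewrite exchange_big.
  by apply: eq_bigr => j _; exact: entry.
split=> [S S' _|S]; rewrite sum1 !sum2.
  rewrite -!big_split; apply: ler_sum => c _ /=.
  exact: (@binary_two_sets R n (P^~ c) (P01^~ c)).
(* The constant k is the total of the slack 1 that each column contributes. *)
have -> : k%:R = \sum_(c < k) 1 :> R by rewrite sumr_const card_ord.
rewrite -big_split; apply: ler_sum => c _ /=.
exact: (@binary_one_set R n (P^~ c) (P01^~ c)).
Qed.
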